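(* Let $b\geq 2$ be an integer, let $d\in\{0,1,\dots,b-1\}$, and let $\varepsilon>0$, $\delta>0$. Then there exists a Lebesgue measurable set $E_{\delta}\subset[0,1)$ of Lebesgue measure at most $\delta$ such that for every $\alpha\in[0,1)\setminus E_\delta$ and every $N\in\mathbb{N}$, \[ A(d,b,N)\leq\min\left\{N,\;\frac{N}{b}+K_{\varepsilon,\delta}\,N^{2/3}\log^{1/3+\varepsilon}(N+2)\right\}, \] where \[ K_{\varepsilon,\delta}=\max\left\{\frac{N_{\varepsilon,\delta}}{\max\left(b^{-2/3}\log^{1/3+\varepsilon}(1/b+2),1\right)},\;\frac{4}{\log^{2\varepsilon/3}(1/b+2)}\left(\frac{\log 4}{\log 3}\right)^{1+\varepsilon}\left(4+\frac{1+\varepsilon}{\log 3}+\frac{1}{4\log^{1+\varepsilon}4}\right)\right\}, \] \[ N_{\varepsilon,\delta}=\min\left\{n\in\mathbb{N}:\frac{n}{b}>j^3\log^{1+\varepsilon}(j+2)\right\},\qquad j=1+\left\lceil\exp\left(\left(\frac{1+\log^{-1-\varepsilon}3}{\varepsilon\delta}\right)^{1/\varepsilon}\right)\right\rceil. \]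
   Context: Every real $\alpha$ has a unique base-$b$ expansion $\alpha=[\alpha]+\sum_{n\geq1}a_nb^{-n}$ with $[\alpha]$ the integer part, digits $0\leq a_n<b$, and $a_n<b-1$ for infinitely many $n$. $A(d,b,N)$ denotes the number of indices $n\in\{1,\dots,N\}$ with $a_n=d$. *)

(* Defs.v *)
From HB Require Import structures.
From mathcomp Require Import all_boot all_order all_algebra.
From mathcomp Require Import zify.
From mathcomp Require Import all_classical all_reals all_analysis.

Set Implicit Arguments.
Unset Strict Implicit.
Unset Printing Implicit Defensive.

Import Order.TTheory GRing.Theory Num.Theory.
Import numFieldNormedType.Exports.

Local Open Scope classical_set_scope.
Local Open Scope ring_scope.

(* [a n] is the digit of b^-n for n >= 1; the value [a 0] is irrelevant. *)
Definition is_base_expansion (R : realType) (b : nat) (alpha : R)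
    (a : nat -> nat) : Prop :=
  [/\ forall n, (0 < n)%N -> (a n < b)%N,
      infinite_set [set n | (a n < b.-1)%N] &
      (Num.floor alpha)%:~R + \sum_(1 <= n < N) (a n)%:R / b%:R ^+ n
        @[N --> \oo] --> alpha].

(* Well defined for n >= 1 when 2 <= b, by the lemmas [base_expansion_exists]
   and [base_expansion_unique]. *)
Definition digit (R : realType) (b : nat) (alpha : R) : nat -> nat :=
  xget (fun=> 0%N) [set a | is_base_expansion b alpha a].

Definition digit_count (R : realType) (d b N : nat) (alpha : R) : nat :=
  (\sum_(1 <= n < N.+1) (digit b alpha n == d))%N.

(* The Caratheodory sigma-algebra of the Lebesgue outer measure, i.e. the
   completion of the Borel sets ([completed_caratheodory_measurable]). *)
Definition lebesgue_measurable (R : realType) (E : set R) : Prop :=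
  ((@wlength R idfun)^*)%mu.-cara.-measurable E.

Definition j_index (R : realType) (eps delta : R) : R :=
  1 + (Num.ceil (expR
    (((1 + (ln 3) `^ (-1 - eps)) / (eps * delta)) `^ (eps^-1))))%:~R.

(* The set is nonempty when 0 < b ([N_index_exists]). *)
Definition N_index (R : realType) (b : nat) (eps delta : R) : nat :=
  let j := j_index eps delta in
  let S := [set n : nat | n%:R / b%:R > j ^+ 3 * (ln (j + 2)) `^ (1 + eps)] in
  xget 0%N [set n | S n /\ forall m, S m -> (n <= m)%N].

Definition K_const (R : realType) (b : nat) (eps delta : R) : R :=
  Num.max
    ((N_index b eps delta)%:R /
       Num.max (b%:R `^ (- (2 / 3)) * (ln (b%:R^-1 + 2)) `^ (1 / 3 + eps)) 1)
    (4 / (ln (b%:R^-1 + 2)) `^ (2 * eps / 3) *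
       (ln 4 / ln 3) `^ (1 + eps) *
       (4 + (1 + eps) / ln 3 + 1 / (4 * (ln 4) `^ (1 + eps)))).

Lemma N_index_exists (R : realType) (b : nat) (hb : (0 < b)%N) (eps delta : R) :
  let j := j_index eps delta in
  let S := [set n : nat | n%:R / b%:R > j ^+ 3 * (ln (j + 2)) `^ (1 + eps)] in
  S (N_index b eps delta) /\ forall m, S m -> (N_index b eps delta <= m)%N.
Proof.
move=> j S; rewrite /N_index -/j -/S.
apply: (@xgetPex _ 0%N [set n | S n /\ forall m, S m -> (n <= m)%N]).
have b0 : 0 < b%:R :> R by rewrite ltr0n.
have ex : exists n : nat, j ^+ 3 * (ln (j + 2)) `^ (1 + eps) < n%:R / b%:R.
  exists (Num.truncn (b%:R * (j ^+ 3 * (ln (j + 2)) `^ (1 + eps)))).+1.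
  by rewrite ltr_pdivlMr// mulrC truncnS_gt.
by exists (ex_minn ex); case: ex_minnP.
Qed.

Section base_expansion.
Context (R : realType) (b : nat) (alpha : R) (hb : (1 < b)%N).

Let x : R := alpha - (Num.floor alpha)%:~R.
Let t n : nat := Num.truncn (x * b%:R ^+ n).

Let bn_gt0 n : 0 < b%:R ^+ n :> R.
Proof. by rewrite exprn_gt0// ltr0n ltnW. Qed.

Let x_ge0 : 0 <= x. Proof. by rewrite subr_ge0 floor_le. Qed.

Let x_lt1 : x < 1.
Proof. by rewrite ltrBlDl; have := floorD1_gt alpha; rewrite intrD1. Qed.

Let t_itv n : (t n)%:R <= x * b%:R ^+ n < (t n)%:R + 1.
Proof. by rewrite natr1; apply: truncn_itv; rewrite mulr_ge0// ltW. Qed.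

Let t0 : t 0 = 0%N.
Proof.
by apply/eqP; rewrite /t expr0 mulr1 truncn_eq// x_lt1 x_ge0.
Qed.

Let tS n : (b * t n <= t n.+1 < b * t n + b)%N.
Proof.
have /andP[l1 u1] := t_itv n; have /andP[l2 u2] := t_itv n.+1.
move: l2 u2; rewrite exprS mulrCA => l2 u2.
have b0 : 0 < b%:R :> R by rewrite ltr0n ltnW.
apply/andP; split.
- rewrite -ltnS -(ltr_nat R) natrM -natr1; apply: le_lt_trans u2.
  by rewrite ler_pM2l.
- rewrite -(ltr_nat R) natrD natrM; apply: le_lt_trans l2 _.
  by rewrite -[ltRHS]/(_ * _ + _) -[X in _ + X]mulr1 -mulrDr ltr_pM2l.
Qed.

Let invb_cvg : (b%:R ^+ n)^-1 @[n --> \oo] --> (0 : R).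
Proof.
have := @cvg_geometric R 1 b%:R^-1.
rewrite ger0_norm ?invr_ge0// invf_lt1 ?ltr0n ?ltr1n//; last exact: ltnW.
move=> /(_ hb) h; apply: cvg_trans h; apply: near_eq_cvg; near=> n.
by rewrite /geometric/= mul1r exprVn.
Unshelve. all: by end_near. Qed.

Lemma base_expansion_exists : exists a, is_base_expansion b alpha a.
Proof.
pose a n := (t n - b * t n.-1)%N.
have aE n : t n.+1 = (b * t n + a n.+1)%N.
  by rewrite /a/= subnKC//; case/andP: (tS n).
have sumE N : \sum_(1 <= n < N.+1) (a n)%:R / b%:R ^+ n
    = (t N)%:R / b%:R ^+ N :> R.
  elim: N => [|N IH]; first by rewrite big_geq// t0 mul0r.
  rewrite big_nat_recr//= IH aE natrD natrM mulrDl exprS -mulf_div divff ?mul1r//.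
  by rewrite pnatr_eq0; lia.
exists a; split.
- case=> // n _; have := tS n; have := aE n; lia.
- move=> /finite_fsetP[F FE].
  have [M hM] : exists M, forall n, (M <= n)%N -> a n.+1 = b.-1.
    exists (\max_(i <- finmap.enum_fset F) i)%N => n Mn; apply/eqP.
    have := tS n; have e1 := aE n; move=> e2.
    rewrite eqn_leq; apply/andP; split; first lia.
    rewrite leqNgt; apply/negP => an.
    have : [set n | (a n < b.-1)%N] n.+1 by [].
    rewrite FE.
    move=> /= nF; have : (n.+1 <= \max_(i <- finmap.enum_fset F) i)%N.
      exact: (@leq_bigmax_seq _ _ xpredT id).
    by rewrite ltnNge Mn.
  have tE i : (t (M + i) + 1 = b ^ i * (t M + 1))%N.
    elim: i => [|i IH]; first by rewrite addn0 expn0 mul1n.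
    rewrite (addnS M) aE hM ?leq_addr// expnS -mulnA -IH mulnDr muln1 -addnA.
    by rewrite addn1 prednK// ltnW.
  have le i : (t M + 1)%:R / b%:R ^+ M - x <= (b%:R ^+ (i + M))^-1.
    have /andP[h _] := t_itv (M + i).
    rewrite (addnC i) lerBlDl -(ler_pM2r (bn_gt0 (M + i))) mulrDl mulVf ?gt_eqF//.
    apply: (@le_trans _ _ (t (M + i) + 1)%:R); last by rewrite natrD lerD2r.
    by rewrite tE natrM exprD mulrA divfK ?gt_eqF// natrX mulrC.
  have /andP[_] := t_itv M; rewrite -ltr_pdivlMr//; apply/negP; rewrite -leNgt.
  rewrite natr1 -addn1 -subr_le0.
  have cv : (b%:R ^+ (i + M))^-1 @[i --> \oo] --> (0 : R).
    by rewrite (@cvg_shiftn M R (fun n => (b%:R ^+ n)^-1)).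
  rewrite -(cvg_lim _ cv)//; apply: limr_ge; first by apply: cvgP cv.
  by near=> i; apply: le.
- rewrite -{2}(subrK (Num.floor alpha)%:~R alpha) addrC -/x.
  apply: cvgD; first exact: cvg_cst.
  rewrite -(@cvg_shiftS R); apply: (@squeeze_cvgr _ _ _ _
    (fun n => x - (b%:R ^+ n)^-1) (fun=> x)); last exact: cvg_cst.
    near=> N; rewrite /= sumE; have /andP[l u] := t_itv N; apply/andP; split.
      by rewrite lerBlDr -[X in _ + X]mul1r -mulrDl ler_pdivlMr// ltW.
    by rewrite ler_pdivrMr.
  by rewrite -[X in _ --> X]subr0; apply: cvgB => //; exact: cvg_cst.
Unshelve. all: by end_near. Qed.

Let expansion_prefix a : is_base_expansion b alpha a -> exists s : nat -> nat,
  (forall n, s n.+1 = b * s n + a n.+1)%N /\ forall n, s n = t n.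
Proof.
case=> alt inf cvg.
pose s := fix s n := if n is m.+1 then (b * s m + a m.+1)%N else 0%N.
exists s; split=> // n.
have sumE N : \sum_(1 <= n < N.+1) (a n)%:R / b%:R ^+ n
    = (s N)%:R / b%:R ^+ N :> R.
  elim: N => [|N IH]; first by rewrite big_geq// mul0r.
  rewrite big_nat_recr//= IH natrD natrM mulrDl exprS -mulf_div divff ?mul1r//.
  by rewrite pnatr_eq0; lia.
have cs : (s N)%:R / b%:R ^+ N @[N --> \oo] --> x.
  have -> : (fun N => (s N)%:R / b%:R ^+ N) = (fun N => (Num.floor alpha)%:~R +
      \sum_(1 <= n < N.+1) (a n)%:R / b%:R ^+ n - (Num.floor alpha)%:~R) :> (_ -> R).
    by apply/funext => N; rewrite sumE addrAC subrr add0r.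
  apply: cvgB; last exact: cvg_cst.
  by rewrite (@cvg_shiftS R (fun N => (Num.floor alpha)%:~R +
    \sum_(1 <= n < N) (a n)%:R / b%:R ^+ n)).
pose u N : R := (s N + 1)%:R / b%:R ^+ N.
have cu : u N @[N --> \oo] --> x.
  have -> : u = (fun N => (s N)%:R / b%:R ^+ N + (b%:R ^+ N)^-1).
    by apply/funext => N; rewrite /u natrD mulrDl mul1r.
  by rewrite -[X in _ --> X]addr0; apply: cvgD.
have step (p q N : nat) : (p <= b * q)%N -> p%:R / b%:R ^+ N.+1 <= q%:R / b%:R ^+ N :> R.
  move=> h; rewrite ler_pdivrMr// exprSr mulrA divfK ?gt_eqF//.
  by rewrite -natrM ler_nat mulnC.
have uS N : u N.+1 <= u N.
  by apply: step => /=; have := alt N.+1 isT; rewrite mulnDr; lia.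
have x_le N : x <= u N.
  rewrite -(cvg_lim _ cu)//; apply: nonincreasing_cvgn_ge; last exact: cvgP cu.
  by apply/nonincreasing_seqP.
have s_le : (s n)%:R / b%:R ^+ n <= x.
  rewrite -(cvg_lim _ cs)//.
  apply: (@nondecreasing_cvgn_le _ (fun N => (s N)%:R / b%:R ^+ N)); last exact: cvgP cs.
  apply/nondecreasing_seqP => N.
  rewrite ler_pdivlMr// exprSr mulrA divfK ?gt_eqF//.
  by rewrite -natrM ler_nat mulnC leq_addr.
have [m [nm am]] : exists m, (n <= m)%N /\ (a m.+1 < b.-1)%N.
  apply: contrapT => h; apply: inf.
  apply: (@sub_finite_set _ _ `I_n.+1); last exact: finite_II.
  move=> [|k] //= ak; rewrite ltnS ltnNge; apply/negP => nk.
  by apply: h; exists k.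
have lt_u : x < u n.
  apply: le_lt_trans (x_le m.+1) _; apply: (@lt_le_trans _ _ (u m)).
    rewrite /u ltr_pdivrMr// exprSr mulrA divfK ?gt_eqF// -natrM ltr_nat /=.
    by rewrite [X in (_ < X)%N]mulnC mulnDr; lia.
  have /nonincreasing_seqP ni := uS; exact: ni.
apply/esym/eqP; rewrite /t truncn_eq ?mulr_ge0// ?(ltW (bn_gt0 _))//.
by rewrite -ler_pdivrMr// s_le/= -ltr_pdivlMr// -addn1.
Qed.

Lemma base_expansion_unique a a' :
  is_base_expansion b alpha a -> is_base_expansion b alpha a' ->
  forall n, (0 < n)%N -> a n = a' n.
Proof.
move=> /expansion_prefix[s [sS st]] /expansion_prefix[s' [sS' st']] [|n] // _.
by apply: (@addnI (b * t n)); rewrite -{1}st -st' -sS -sS' st st'.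
Qed.

End base_expansion.

(* Main.v *)
(* The digits of a uniform alpha are independent and uniform, so the number
   A(n) of occurrences of d among the first n has variance at most n/b.
   Chebyshev's inequality at the times n_k, the least n with
   n/b > k^3 log^(1+eps)(k+2), with deviation k^2 log^(1+eps)(k+2), fails on a
   set of measure at most C / (k log^(1+eps) k), C = 1 + log^(-1-eps) 3; the
   tail k >= j sums to at most C / (eps log^eps (j-1)) <= delta.  For
   n_k <= N <= n_{k+1} monotonicity gives A(N) <= A(n_{k+1}), and the gap
   (n_{k+1} - N)/b is of the order of the deviation.  For N < n_j the trivial
   bound A(N) <= N <= N_index suffices. *)
Require Import Defs.
From HB Require Import structures.
From mathcomp Require Import all_boot all_order all_algebra.
From mathcomp Require Import all_classical all_reals all_analysis.
From mathcomp Require Import ring lra zify.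
Set Implicit Arguments.
Unset Strict Implicit.
Unset Printing Implicit Defensive.
Import Order.TTheory GRing.Theory Num.Theory.
Import numFieldNormedType.Exports.
Local Open Scope classical_set_scope.
Local Open Scope ring_scope.

(** * Tangent-line inequalities for logarithms and real powers, and bounds on e *)

Lemma ln_ge_1BV (R : realType) (x : R) : 0 < x -> 1 - x^-1 <= ln x.
Proof.
move=> x0; have : ln (1 + (x^-1 - 1)) <= x^-1 - 1.
  by apply: le_ln1Dx; rewrite ltrDr -subr_gt0 subr0 invr_gt0.
by rewrite addrC subrK lnV ?posrE// lerNl opprB.
Qed.

Lemma powR_ge1Dln (R : realType) (x p : R) : 0 < x -> 1 + p * ln x <= x `^ p.
Proof. by move=> x0; rewrite /powR gt_eqF// expR_ge1Dx. Qed.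

(** A mean value inequality for t^p, valid in either order of u and v: with r = v/u, combine r^p >=
    1 + p ln r and ln r >= 1 - 1/r. *)
Lemma powR_sub_le (R : realType) (u v p : R) : 0 < u -> 0 < v -> 0 <= p ->
  u `^ p - v `^ p <= p * u `^ p * ((u - v) / v).
Proof.
move=> u0 v0 p0; have vu0 : 0 < v / u by rewrite divr_gt0.
have -> : v `^ p = u `^ p * (v / u) `^ p.
  by rewrite -powRM ?ltW// mulrC divfK// gt_eqF.
have := powR_ge1Dln p vu0; have := ln_ge_1BV vu0.
rewrite invf_div mulrBl divff ?gt_eqF// => h1 h2.
have h3 : 1 - p * (u / v - 1) <= (v / u) `^ p.
  apply: le_trans h2; rewrite lerD2l -mulrN ler_wpM2l//; lra.
have := ler_wpM2l (powR_ge0 u p) h3; lra.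
Qed.

(** The analogue for t^(-p), from the same two bounds at r = u/v. *)
Lemma powRN_sub_ge (R : realType) (u v p : R) : 0 < u -> 0 < v -> 0 <= p ->
  p * (u - v) / u `^ (1 + p) <= v `^ (- p) - u `^ (- p).
Proof.
move=> u0 v0 p0; have uv0 : 0 < u / v by rewrite divr_gt0.
have -> : v `^ (- p) = u `^ (- p) * (u / v) `^ p.
  have powNr x : 0 < x -> x `^ (- p) = x^-1 `^ p.
    by move=> x0; rewrite -powR_inv1 ?ltW// -powRrM mulN1r.
  by rewrite !powNr// -powRM ?invr_ge0 ?divr_ge0 ?ltW// mulKf// gt_eqF.
have := powR_ge1Dln p uv0; have := ln_ge_1BV uv0; rewrite invf_div => h1 h2.
have h3 : 1 + p * (1 - v / u) <= (u / v) `^ p.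
  by apply: le_trans h2; rewrite lerD2l ler_wpM2l.
have := ler_wpM2l (powR_ge0 u (- p)) h3.
have -> : p * (u - v) / u `^ (1 + p) = u `^ (- p) * (p * (1 - v / u)).
  rewrite powRD; last by apply/implyP => _; rewrite gt_eqF.
  rewrite powRr1 ?ltW// powRN; have := powR_gt0 p u0.
  by move=> h; field; rewrite !gt_eqF.
lra.
Qed.

Lemma ln_sub_le (R : realType) (x y : R) : 0 < x -> 0 < y ->
  ln x - ln y <= (x - y) / y.
Proof.
move=> x0 y0; have := ln_ge_1BV (divr_gt0 y0 x0).
rewrite ln_div ?posrE// invf_div mulrBl divff ?gt_eqF//; lra.
Qed.

(** Replaces comparison with the integral of 1/(x ln^(1+p) x): [powRN_sub_ge] at ln x and ln (x-1),
    together with ln x - ln (x-1) >= 1/x, gives a right side that telescopes. *)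
Lemma inv_mul_ln_le (R : realType) (x p : R) : 2 < x -> 0 <= p ->
  p / (x * ln x `^ (1 + p)) <= ln (x - 1) `^ (- p) - ln x `^ (- p).
Proof.
move=> x2 p0; have l0 : 0 < ln x by rewrite ln_gt0//; lra.
apply: le_trans (powRN_sub_ge l0 _ p0); last by rewrite ln_gt0//; lra.
have := @ln_sub_le _ (x - 1) x; rewrite addrAC subrr add0r mulN1r => h.
have {}h : x^-1 <= ln x - ln (x - 1) by rewrite -lerN2 opprB h//; lra.
rewrite invfM mulrA ler_wpM2r ?invr_ge0 ?powR_ge0//.
by rewrite ler_wpM2l.
Qed.

Lemma expR1_gt (R : realType) : 5 / 2 <= expR 1 :> R.
Proof.
(* The bound e^y >= 1 + y at y = 1/6, raised to the sixth power, suffices: (7/6)^6 > 5/2. *)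
have -> : (1 : R) = 6%:R * (6^-1) by field.
rewrite expRM_natl; apply: le_trans (lerXn2r 6 _ _ (expR_ge1Dx _)).
- by rewrite !exprS expr0; lra.
- by rewrite nnegrE; lra.
- by rewrite nnegrE expR_ge0.
Qed.

Lemma expR1_le3 (R : realType) : expR 1 <= 3 :> R.
Proof.
have : 1 / 3 <= expR (-1) :> R.
  (* Likewise at y = -1/6, since (5/6)^6 > 1/3. *)
  have -> : (-1 : R) = 6%:R * (- 6^-1) by field.
  rewrite expRM_natl; apply: le_trans (lerXn2r 6 _ _ (expR_ge1Dx _)).
  - by rewrite !exprS expr0; lra.
  - by rewrite nnegrE; lra.
  - by rewrite nnegrE expR_ge0.
by rewrite expRN div1r lef_pV2// posrE ?expR_gt0.
Qed.

Lemma ln3_ge1 (R : realType) : 1 <= ln 3 :> R.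
Proof. by rewrite -[leLHS]expRK ler_ln ?posrE ?expR_gt0// expR1_le3. Qed.

Lemma ln_5half_le1 (R : realType) : ln (5 / 2) <= 1 :> R.
Proof. by rewrite -[leRHS]expRK ler_ln ?posrE ?expR_gt0// expR1_gt. Qed.

(** * Variance of the count of d among n uniform digits, and Chebyshev's inequality *)

(* Occurrences of d among the n lowest base-b digits of c. *)
Fixpoint digit_occ (b d n c : nat) : nat :=
  if n is m.+1 then (digit_occ b d m (c %/ b) + (c %% b == d))%N else 0%N.

Lemma sumr_nat_divmod (V : nmodType) (b m : nat) (F : nat -> nat -> V) :
  (0 < b)%N ->
  \sum_(0 <= c < m * b) F (c %/ b)%N (c %% b)%N =
  \sum_(0 <= q < m) \sum_(0 <= r < b) F q r.
Proof.
move=> b0; rewrite big_nat_mul; apply: eq_bigr => q _.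
rewrite -{1}[(q * b)%N]add0n big_addn mulSn addnK.
apply: eq_big_nat => r /andP[_ rb].
by rewrite [(r + _)%N]addnC divnMDl// modnMDl divn_small// modn_small// addn0.
Qed.

(** Here x is the centred count of the earlier digits. The cross term drops out because the centred
    indicator of d has mean zero over a uniform digit. *)
Lemma sum_sqr_centered_indicator (R : realType) (b d : nat) (x : R) :
  (d < b)%N ->
  \sum_(0 <= r < b) (x + (r == d)%:R - b%:R^-1) ^+ 2 =
  b%:R * x ^+ 2 + (1 - b%:R^-1).
Proof.
move=> db; have b0 : b%:R != 0 :> R by rewrite pnatr_eq0; lia.
pose y := x - b%:R^-1.
have E r : (x + (r == d)%:R - b%:R^-1) ^+ 2 =
    y ^+ 2 + (r == d)%:R * (2 * y + 1).
  by case: (r == d); rewrite /y/=; ring.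
rewrite (eq_bigr _ (fun r _ => E r)) big_split/= -[X in _ + X]mulr_suml.
have -> : \sum_(0 <= r < b) (r == d)%:R = 1 :> R.
  rewrite big_mkord (bigD1 (Ordinal db))//= eqxx big1 ?addr0// => i.
  by rewrite -val_eqE/= => /negPf ->.
by rewrite sumr_const_nat subn0 -mulr_natl /y; field.
Qed.

(** Induction on n: for uniform c, the quotient and the remainder by b are independent and uniform,
    so each digit adds one Bernoulli variance. *)
Lemma digit_occ_second_moment (R : realType) (b d n : nat) : (d < b)%N ->
  \sum_(0 <= c < b ^ n) ((digit_occ b d n c)%:R - n%:R / b%:R) ^+ 2 =
  (b ^ n)%:R * (n%:R * (b%:R^-1 * (1 - b%:R^-1))) :> R.
Proof.
move=> db; have b0 : b%:R != 0 :> R by rewrite pnatr_eq0; lia.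
elim: n => [|n IH].
  by rewrite expn0 big_nat1/= !mul0r mulr0 subrr expr0n.
pose F q r : R :=
  ((digit_occ b d n q)%:R - n%:R / b%:R + (r == d)%:R - b%:R^-1) ^+ 2.
rewrite expnSr (eq_bigr (fun c => F (c %/ b)%N (c %% b)%N)); last first.
  move=> c _; rewrite /F/= natrD; congr (_ ^+ 2).
  by rewrite -natr1; field.
rewrite sumr_nat_divmod; last by lia.
rewrite (eq_bigr _ (fun c _ => sum_sqr_centered_indicator _ db)).
rewrite big_split/= -mulr_sumr IH sumr_const_nat subn0 -natr1 natrM.
by rewrite -(mulr_natl _ (b ^ n)); field.
Qed.

Lemma digit_occ_chebyshev (R : realType) (b d n : nat) (t : R) :
  (d < b)%N -> 0 < t ->
  (\sum_(0 <= c < b ^ n) ((n%:R / b%:R + t < (digit_occ b d n c)%:R)%R : nat))%:R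
  / (b ^ n)%:R <= n%:R / b%:R / t ^+ 2 :> R.
Proof.
move=> db t0; have b0 : 0 < b%:R :> R by rewrite ltr0n; lia.
have bn0 : 0 < (b ^ n)%:R :> R by rewrite natrX exprn_gt0.
rewrite ler_pdivrMr// mulrAC ler_pdivlMr ?exprn_gt0//.
apply: (@le_trans _ _ ((b ^ n)%:R * (n%:R * (b%:R^-1 * (1 - b%:R^-1))))).
  rewrite -(digit_occ_second_moment _ _ db) natr_sum mulr_suml.
  apply: ler_sum => c _; case: ltP => /= h; rewrite ?mul0r ?sqr_ge0// mul1r.
  by apply: lerXn2r; rewrite ?nnegrE; lra.
rewrite [leRHS]mulrC ler_pM2l// ler_wpM2l// ler_piMr ?invr_ge0 ?(ltW b0)//.
Qed.

(** * Digits of real numbers and covers of the exceptional sets *)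

Lemma digit_is_base_expansion (R : realType) (b : nat) (alpha : R) :
  (1 < b)%N -> is_base_expansion b alpha (digit b alpha).
Proof. by move=> b1; apply: xgetPex; exact: base_expansion_exists. Qed.

(* The interval is closed: at its right end alpha could only be excluded by
   using that infinitely many digits differ from b-1, which a cover of small
   measure does not need. *)
Lemma digit_prefix (R : realType) (b d N : nat) (alpha : R) : (1 < b)%N ->
  0 <= alpha < 1 ->
  exists c : nat, [/\ (c < b ^ N)%N, digit_occ b d N c = digit_count d b N alpha
    & c%:R / (b ^ N)%:R <= alpha <= c.+1%:R / (b ^ N)%:R].
Proof.
move=> b1 a01; have [] := digit_is_base_expansion alpha b1.
rewrite /digit_count; move: (digit b alpha) => a alt _ cvg.
have b0 : 0 < b%:R :> R by rewrite ltr0n ltnW.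
have bn0 n : 0 < (b ^ n)%:R :> R by rewrite natrX exprn_gt0.
(* [s n] is the integer with digits a 1, ..., a n, so s n / b^n is a partial sum of the expansion;
   [s N] is the witness c. *)
pose s := fix s n := if n is m.+1 then (b * s m + a m.+1)%N else 0%N.
have sS n : s n.+1 = (b * s n + a n.+1)%N by [].
have sumE n : \sum_(1 <= i < n.+1) (a i)%:R / b%:R ^+ i
    = (s n)%:R / (b ^ n)%:R :> R.
  elim: n => [|n IH]; first by rewrite big_geq// mul0r.
  rewrite big_nat_recr//= IH natrD natrM expnS natrM natrX exprS.
  by field; rewrite expf_neq0 gt_eqF.
have f0 : Num.floor alpha = 0 by apply/eqP; rewrite floor_eq.
have cs : (s n)%:R / (b ^ n)%:R @[n --> \oo] --> alpha.
  move: cvg; rewrite f0 -(@cvg_shiftS R).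
  by under eq_fun do rewrite add0r sumE.
have slt n : (s n < b ^ n)%N.
  elim: n => [//|n IH]; rewrite sS expnS.
  have := leq_mul (leqnn b) IH; have := alt n.+1 isT; rewrite mulnS; lia.
exists (s N); split => //.
- elim: N => [|n IH]; first by rewrite big_geq.
  rewrite big_nat_recr//= -IH [(b * _)%N]mulnC divnMDl ?modnMDl; last lia.
  by have h := alt n.+1 isT; rewrite divn_small// modn_small// addn0.
- apply/andP; split.
    rewrite -(cvg_lim _ cs)//.
    apply: (@nondecreasing_cvgn_le _ (fun n => (s n)%:R / (b ^ n)%:R));
      last exact: cvgP cs.
    apply/nondecreasing_seqP => n; rewrite sS expnS natrM natrD natrM.
    rewrite ler_pdivlMr ?mulr_gt0// mulrCA -mulrA mulVf ?gt_eqF// mulr1.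
    by rewrite mulrC lerDl.
  (* The upper ends (s n + 1) / b^n never increase, as a digit is at most b - 1, so the limit stays
     below the upper end at N. *)
  suff h n : (N <= n)%N -> (s n)%:R / (b ^ n)%:R <= (s N).+1%:R / (b ^ N)%:R :> R.
    rewrite -(cvg_lim _ cs)//; apply: limr_le; first exact: cvgP cs.
    by exists N => // n /=; exact: h.
  move=> Nn; apply: (@le_trans _ _ ((s n).+1%:R / (b ^ n)%:R)).
    by rewrite ler_wpM2r ?invr_ge0 ?ltW// ltr_nat.
  elim: n Nn => [|n IH]; first by rewrite leqn0 => /eqP ->.
  rewrite leq_eqVlt => /predU1P[-> //|/IH]; apply: le_trans.
  rewrite ler_pdivrMr// expnSr natrM mulrA divfK ?gt_eqF// -natrM ler_nat.
  by rewrite sS mulSn addnC; have := alt n.+1 isT; rewrite mulnC; lia.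
Qed.

(** Covers, by closed prefix intervals, the event that the count of d exceeds its mean n/b by more
    than t; only right endpoints are added. *)
Definition digit_excess_cover (R : realType) (b d n : nat) (t : R) : set R :=
  \big[setU/set0]_(c < b ^ n)
    if n%:R / b%:R + t < (digit_occ b d n c)%:R
    then `[c%:R / (b ^ n)%:R, c.+1%:R / (b ^ n)%:R]%classic else set0.

Lemma measurable_digit_excess_cover (R : realType) (b d n : nat) (t : R) :
  measurable (digit_excess_cover b d n t).
Proof. by apply: bigsetU_measurable => c _; case: ifP. Qed.

Lemma digit_excess_coverP (R : realType) (b d n : nat) (t alpha : R) :
  (1 < b)%N -> 0 <= alpha < 1 -> ~ digit_excess_cover b d n t alpha ->
  (digit_count d b n alpha)%:R <= n%:R / b%:R + t.
Proof.
move=> b1 a01 nE; have [c [cb <- ca]] := digit_prefix d n b1 a01.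
rewrite leNgt; apply/negP => h; apply: nE.
rewrite /digit_excess_cover -(bigcup_mkord _ (fun c =>
  if n%:R / b%:R + t < (digit_occ b d n c)%:R
  then `[c%:R / (b ^ n)%:R, c.+1%:R / (b ^ n)%:R]%classic else set0)).
by exists c => //; rewrite h /= in_itv.
Qed.

(** Each selected interval has length b^-n, so finite subadditivity reduces the claim to the
    proportion of bad prefixes, which [digit_occ_chebyshev] bounds. *)
Lemma digit_excess_cover_measure (R : realType) (b d n : nat) (t : R) :
  (d < b)%N -> 0 < t ->
  (lebesgue_measure (digit_excess_cover b d n t) <=
    (n%:R / b%:R / t ^+ 2)%:E)%E.
Proof.
move=> db t0; have bn0 : 0 < (b ^ n)%:R :> R by rewrite ltr0n expn_gt0; lia.
pose F (c : nat) : set R := if n%:R / b%:R + t < (digit_occ b d n c)%:R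
  then `[c%:R / (b ^ n)%:R, c.+1%:R / (b ^ n)%:R]%classic else set0.
have mF c : measurable (F c) by rewrite /F; case: ifP.
apply: (@le_trans _ _ (\sum_(c < b ^ n) lebesgue_measure (F c))%E).
  have mE := measurable_digit_excess_cover b d n t.
  exact: (content_subadditive lebesgue_measure (fun k _ => mF k) mE).
apply: (@le_trans _ _ (\sum_(c < b ^ n)
   ((n%:R / b%:R + t < (digit_occ b d n c)%:R)%R%:R / (b ^ n)%:R)%:E)%E).
  apply: lee_sum => c _; rewrite /F; case: ifP => _; last first.
    by rewrite measure0 mul0r.
  rewrite lebesgue_measure_itv/= lte_fin ltr_pM2r ?invr_gt0// ltr_nat ltnSn.
  by rewrite -EFinB lee_fin -mulrBl -natrB ?leqnSn// subSnn.
rewrite sumEFin lee_fin -mulr_suml; apply: le_trans (digit_occ_chebyshev n db t0).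
by rewrite -natr_sum big_mkord.
Qed.

(** * Block times, allowed deviations and their growth *)

(** The scale of n_k / b, with [quad_log] the deviation allowed at n_k. The ratio [cubic_log] /
    [quad_log]^2 is 1 / (x ln^(1+eps) (x+2)), which is summable, and [quad_log] has the order of the
    increments of [cubic_log]. *)
Definition cubic_log (R : realType) (eps x : R) : R :=
  x ^+ 3 * ln (x + 2) `^ (1 + eps).

Definition quad_log (R : realType) (eps x : R) : R :=
  x ^+ 2 * ln (x + 2) `^ (1 + eps).

(** The time n_k: the successor of the truncation is the least integer strictly above b times
    [cubic_log]. *)
Definition block_end (R : realType) (b : nat) (eps : R) (k : nat) : nat :=
  (Num.truncn (b%:R * cubic_log eps k%:R)).+1.

Lemma cubic_log_ge0 (R : realType) (eps x : R) : 0 <= x -> 0 <= cubic_log eps x.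
Proof. by move=> x0; rewrite mulr_ge0 ?powR_ge0// exprn_ge0. Qed.

Lemma block_end_gt (R : realType) (b : nat) (eps : R) (k : nat) : (0 < b)%N ->
  cubic_log eps k%:R < (block_end b eps k)%:R / b%:R.
Proof.
by move=> b0; rewrite ltr_pdivlMr ?ltr0n// mulrC truncnS_gt.
Qed.

Lemma block_end_le (R : realType) (b : nat) (eps : R) (k : nat) : (0 < b)%N ->
  (block_end b eps k)%:R / b%:R <= cubic_log eps k%:R + 1.
Proof.
move=> b0; rewrite ler_pdivrMr ?ltr0n// mulrDl mul1r mulrC -natr1 lerD ?ler1n//.
by rewrite truncn_le// mulr_ge0// cubic_log_ge0.
Qed.

Lemma block_chebyshev_le (R : realType) (b : nat) (eps : R) (k : nat) :
  (0 < b)%N -> 0 < eps -> (1 < k)%N ->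
  (block_end b eps k)%:R / b%:R / quad_log eps k%:R ^+ 2 <=
    (1 + ln 3 `^ (-1 - eps)) / (k%:R * ln k%:R `^ (1 + eps)).
Proof.
move=> b0 e0 k1; have k0 : 1 < k%:R :> R by rewrite ltr1n.
have := block_end_le eps k b0; move: (_ / b%:R) k0; move: k%:R => x y k0 hy.
set L := ln (x + 2) `^ (1 + eps).
have l3 : 1 <= ln 3 :> R := ln3_ge1 R.
have p0 : 0 <= 1 + eps by lra.
have lk : 0 < ln x by rewrite ln_gt0.
have L3 : ln 3 `^ (1 + eps) <= L.
  apply: ge0_ler_powR; rewrite ?nnegrE ?ln_ge0 ?ler_ln ?posrE//; lra.
have Lk : ln x `^ (1 + eps) <= L.
  apply: ge0_ler_powR; rewrite ?nnegrE ?ln_ge0 ?ler_ln ?posrE//; lra.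
have L30 : 0 < ln 3 `^ (1 + eps) :> R by rewrite powR_gt0//; lra.
have Lk0 : 0 < ln x `^ (1 + eps) by rewrite powR_gt0.
have L0 : 0 < L by lra.
have -> : ln 3 `^ (-1 - eps) = (ln 3 `^ (1 + eps))^-1 :> R.
  by rewrite -powRN opprD.
have x0 : 0 < x by lra.
have x3 : 1 <= x ^+ 3 by rewrite exprn_ege1 ?ltW.
rewrite /cubic_log /quad_log -/L in hy *; clearbody L.
move: (ln 3 `^ _) (ln x `^ _) L3 Lk L30 Lk0 => T S TL SL T0 S0.
have -> : (x ^+ 2 * L) ^+ 2 = x ^+ 3 * L * (x * L) by ring.
rewrite ler_pdivlMr; last exact: mulr_gt0.
rewrite mulrAC ler_pdivrMr; last by do 2?apply: mulr_gt0 => //; lra.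
(* The rounding error 1 is at most x^3 L / T, as x^3 >= 1 and L >= T; this is the origin of the
   factor 1 + ln^(-1-eps) 3. *)
have h : y <= (1 + T^-1) * (x ^+ 3 * L).
  apply: le_trans hy _; rewrite [leRHS]mulrDl mul1r lerD2l [leRHS]mulrC.
  by rewrite ler_pdivlMr ?mul1r; nra.
apply: (@le_trans _ _ ((1 + T^-1) * (x ^+ 3 * L) * (x * S))).
  by rewrite ler_pM2r ?mulr_gt0.
rewrite -!mulrA ler_pM2l; last by rewrite addr_gt0 ?invr_gt0.
by rewrite !ler_pM2l ?(ler_pM2l L0) //; lra.
Qed.

(** By [inv_mul_ln_le] the sum telescopes; the bound is free of n and so passes to the infinite
    tail. *)
Lemma sum_inv_mul_ln_le (R : realType) (eps : R) (j n : nat) :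
  0 < eps -> (2 < j)%N ->
  \sum_(j <= k < n) (k%:R * ln k%:R `^ (1 + eps))^-1 <=
    (eps * ln (j%:R - 1) `^ eps)^-1.
Proof.
move=> e0 j2; rewrite invfM -powRN -ler_pdivrMl ?invr_gt0// invrK mulr_sumr.
have [nj|jn] := leqP n j; first by rewrite big_geq ?powR_ge0.
pose g k : R := - ln (k%:R - 1) `^ (- eps).
apply: (@le_trans _ _ (\sum_(j <= k < n) (g k.+1 - g k))).
  rewrite big_seq [leRHS]big_seq; apply: ler_sum => k.
  rewrite mem_index_iota => /andP[jk _].
  rewrite /g -natr1 addrK opprK [leRHS]addrC; apply: inv_mul_ln_le; last exact: ltW.
  by rewrite ltr_nat; lia.
rewrite telescope_sumr ?(ltnW jn)// /g opprK addrC gerDl oppr_le0.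
exact: powR_ge0.
Qed.

(** With U and V the log powers at x+1 and x, split the difference as ((x+1)^3 - x^3) U + x^3 (U -
    V). The first term yields the 3, the second yields (1+eps)/ln 3 by [powR_sub_le]. *)
Lemma cubic_log_step (R : realType) (eps x : R) : 0 < eps -> 1 <= x ->
  cubic_log eps (x + 1) - cubic_log eps x <=
    quad_log eps (x + 1) * (3 + (1 + eps) / ln 3).
Proof.
move=> e0 x1; rewrite /cubic_log /quad_log -addrA [1 + 2]addrC addrA.
have l3 : 1 <= ln 3 :> R := ln3_ge1 R.
have l2 : ln 3 <= ln (x + 2) by rewrite ler_ln ?posrE//; lra.
set u := ln (x + 2 + 1); set v := ln (x + 2) in l2 *.
have vu : v <= u by rewrite ler_ln ?posrE//; lra.
have uv : u - v <= (x + 2)^-1.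
  have := @ln_sub_le _ (x + 2 + 1) (x + 2).
  by rewrite [X in X / _]addrC addKr mul1r; apply; lra.
have p0 : 0 <= 1 + eps by lra.
have h := @powR_sub_le _ u v (1 + eps); move/(_ _ _ p0): h => h.
have {}h : u `^ (1 + eps) - v `^ (1 + eps) <=
   (1 + eps) * u `^ (1 + eps) * ((u - v) / v) by apply: h; lra.
set U := u `^ (1 + eps) in h *; set V := v `^ (1 + eps) in h *.
have U0 : 0 <= U by exact: powR_ge0.
have pU0 : 0 <= (1 + eps) * U by rewrite mulr_ge0.
have x3 : 0 <= x ^+ 3 by rewrite exprn_ge0//; lra.
have h1 : x ^+ 3 * (U - V) <= (x + 1) ^+ 2 * U * ((1 + eps) / ln 3).
  apply: le_trans (ler_wpM2l x3 h) _.
  have -> : (x + 1) ^+ 2 * U * ((1 + eps) / ln 3) =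
    (1 + eps) * U * ((x + 1) ^+ 2 / ln 3) by ring.
  rewrite mulrCA ler_wpM2l//.
  apply: (@le_trans _ _ (x ^+ 3 * ((x + 2)^-1 / ln 3))).
    rewrite ler_wpM2l// ler_pM ?subr_ge0 ?invr_ge0//; first lra.
    by rewrite lef_pV2 ?posrE//; lra.
  rewrite mulrA ler_wpM2r ?invr_ge0//; first lra.
  by rewrite ler_pdivrMr; nra.
have h2 : ((x + 1) ^+ 3 - x ^+ 3) * U <= (x + 1) ^+ 2 * U * 3.
  have -> : (x + 1) ^+ 2 * U * 3 = ((x + 1) ^+ 2 * 3) * U by ring.
  by rewrite ler_wpM2r//; nra.
lra.
Qed.

(** Both ratios are largest at x = 1: (x+1)^2 / x^2 is then 4, and ln (x+3) / ln (x+2) is ln 4 / ln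
    3. *)
Lemma quad_log_step (R : realType) (eps x : R) : 0 < eps -> 1 <= x ->
  quad_log eps (x + 1) <= 4 * (ln 4 / ln 3) `^ (1 + eps) * quad_log eps x.
Proof.
move=> e0 x1; rewrite /quad_log -addrA [1 + 2]addrC addrA.
have l3 : 1 <= ln 3 :> R := ln3_ge1 R.
have l2 : ln 3 <= ln (x + 2) by rewrite ler_ln ?posrE//; lra.
have l4 : ln 3 <= ln 4 :> R by rewrite ler_ln ?posrE//; lra.
have hr : ln (x + 2 + 1) - ln (x + 2) <= ln 4 - ln 3.
  rewrite -!ln_div ?posrE; try lra.
  rewrite ler_ln ?posrE ?divr_gt0//; try lra.
  by rewrite ler_pdivrMr; lra.
have r : ln (x + 2 + 1) <= ln 4 / ln 3 * ln (x + 2).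
  rewrite mulrAC ler_pdivlMr; last lra.
  by nra.
have -> : 4 * (ln 4 / ln 3) `^ (1 + eps) * (x ^+ 2 * ln (x + 2) `^ (1 + eps)) =
    (4 * x ^+ 2) * (ln 4 / ln 3 * ln (x + 2)) `^ (1 + eps).
  have l0 : 0 <= ln (x + 2) by lra.
  by rewrite (powRM _ _ l0); [ring | rewrite divr_ge0//; lra].
apply: ler_pM; rewrite ?powR_ge0 ?sqr_ge0//; first nra.
apply: ge0_ler_powR; rewrite ?nnegrE ?ln_ge0//; try lra.
by apply: le_trans r; rewrite ln_ge0//; lra.
Qed.

(** Total error on a block: gap, rounding loss 1, and deviation at its end. In the constant, 4 = 3 +
    1 joins gap and deviation; the last fraction pays for rounding, since [quad_log] at x+1 is at
    least 4 ln^(1+eps) 4. *)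
Lemma block_gap_le (R : realType) (eps x : R) : 0 < eps -> 1 <= x ->
  cubic_log eps (x + 1) - cubic_log eps x + 1 + quad_log eps (x + 1) <=
    4 * (ln 4 / ln 3) `^ (1 + eps) *
      (4 + (1 + eps) / ln 3 + 1 / (4 * ln 4 `^ (1 + eps))) * quad_log eps x.
Proof.
move=> e0 x1; have := cubic_log_step e0 x1; have := quad_log_step e0 x1.
have l3 : 1 <= ln 3 :> R := ln3_ge1 R.
have l4 : ln 3 <= ln 4 :> R by rewrite ler_ln ?posrE//; lra.
have L40 : 0 < ln 4 `^ (1 + eps) :> R by rewrite powR_gt0//; lra.
have h1 : 1 <= quad_log eps (x + 1) * (1 / (4 * ln 4 `^ (1 + eps))).
  rewrite mulrA mulr1 ler_pdivlMr ?mulr_gt0// mul1r /quad_log.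
  apply: ler_pM; rewrite ?(ltW L40)//; first nra.
  apply: ge0_ler_powR; rewrite ?nnegrE ?ler_ln ?ln_ge0 ?posrE//; lra.
have c0 : 0 <= (1 + eps) / ln 3 by rewrite divr_ge0//; lra.
have c1 : 0 <= 1 / (4 * ln 4 `^ (1 + eps)) by rewrite divr_ge0// mulr_ge0// ltW.
move=> h2 h3.
have := ler_wpM2r (addr_ge0 (addr_ge0 _ c0) c1) h2; move/(_ 4); lra.
Qed.

Lemma le_cubic_log (R : realType) (eps x : R) :
  0 < eps -> 1 <= x -> x <= cubic_log eps x.
Proof.
move=> e0 x1; have l3 : 1 <= ln 3 :> R := ln3_ge1 R.
have l2 : ln 3 <= ln (x + 2) by rewrite ler_ln ?posrE//; lra.
have L1 : 1 <= ln (x + 2) `^ (1 + eps).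
  by rewrite -[leLHS](powRr0 (ln (x + 2))) ler_powR//; lra.
apply: (@le_trans _ _ (x ^+ 3)); first by rewrite ler_eXnr.
by rewrite ler_peMr// exprn_ge0//; lra.
Qed.

(** Eliminates x through x^2 = (x^3)^(2/3). This leaves a logarithm to the power (1+eps)/3 =
    (1/3+eps) - 2 eps/3, and the missing power of ln (N/b + 2) is bounded below by that of ln (1/b +
    2). *)
Lemma quad_log_le (R : realType) (b N : nat) (eps x : R) :
  (0 < b)%N -> (0 < N)%N -> 0 < eps -> 1 <= x ->
  cubic_log eps x <= N%:R / b%:R ->
  quad_log eps x <= N%:R `^ (2 / 3) * ln (N%:R + 2) `^ (1 / 3 + eps) /
    ln (b%:R^-1 + 2) `^ (2 * eps / 3).
Proof.
move=> b0 N0 e0 x1 h.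
have N1 : 1 <= N%:R :> R by rewrite ler1n.
have b1 : 1 <= b%:R :> R by rewrite ler1n.
have bi0 : 0 < b%:R^-1 :> R by rewrite invr_gt0; lra.
have bi1 : b%:R^-1 <= 1 :> R by rewrite invf_le1//; lra.
have yb : b%:R^-1 <= N%:R / b%:R :> R by rewrite ler_peMl// ltW.
have yN : N%:R / b%:R <= N%:R :> R by rewrite ler_piMr//; lra.
set y := N%:R / b%:R in h yb yN *.
have l3 : 1 <= ln 3 :> R := ln3_ge1 R.
have l2 : ln 3 <= ln (x + 2) by rewrite ler_ln ?posrE//; lra.
set l := ln (x + 2) in l2 *.
have xy : x <= y := le_trans (le_cubic_log e0 x1) h.
have ly : l <= ln (y + 2) by rewrite ler_ln ?posrE//; lra.
have lN : ln (y + 2) <= ln (N%:R + 2) by rewrite ler_ln ?posrE//; lra.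
have lb : ln (b%:R^-1 + 2) <= ln (y + 2) :> R by rewrite ler_ln ?posrE//; lra.
have lb0 : 0 < ln (b%:R^-1 + 2) :> R by rewrite ln_gt0//; lra.
have -> : quad_log eps x = cubic_log eps x `^ (2 / 3) * l `^ ((1 + eps) / 3).
  rewrite /quad_log /cubic_log -/l powRM ?powR_ge0 ?exprn_ge0//; try lra.
  rewrite -powR_mulrn; last lra.
  rewrite -powR_mulrn; last lra.
  rewrite -!powRrM -mulrA -powRD; last by apply/implyP => _; rewrite gt_eqF//; lra.
  by congr (_ `^ _ * _ `^ _); field.
rewrite -mulrA; apply: ler_pM; rewrite ?powR_ge0//.
  apply: ge0_ler_powR; rewrite ?nnegrE ?cubic_log_ge0//; lra.
rewrite ler_pdivlMr ?powR_gt0//.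
apply: (@le_trans _ _ (ln (y + 2) `^ ((1 + eps) / 3) * ln (y + 2) `^ (2 * eps / 3))).
  by apply: ler_pM; rewrite ?powR_ge0//;
    apply: ge0_ler_powR; rewrite ?nnegrE; lra.
rewrite -powRD; last by apply/implyP => _; rewrite gt_eqF//; lra.
have -> : (1 + eps) / 3 + 2 * eps / 3 = 1 / 3 + eps by field.
by apply: ge0_ler_powR; rewrite ?nnegrE; lra.
Qed.

(** * Digit counts, the constants of the statement, and assembly *)

Lemma digit_count_le (R : realType) (d b N : nat) (alpha : R) :
  (digit_count d b N alpha <= N)%N.
Proof.
apply: (@leq_trans (\sum_(1 <= n < N.+1) 1)).
  by apply: leq_sum => n _; exact: leq_b1.
by rewrite sum_nat_const_nat muln1 subn1.
Qed.

Lemma leq_digit_count (R : realType) (d b M N : nat) (alpha : R) :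
  (M <= N)%N -> (digit_count d b M alpha <= digit_count d b N alpha)%N.
Proof.
by move=> MN; rewrite /digit_count [leqRHS](@big_cat_nat _ _ _ M.+1)//= leq_addr.
Qed.

(** The exponential in [j_index] inverts ln^eps, making the tail bound at j at most delta. It
    exceeds 1, so its ceiling is at least 2 and j >= 3. *)
Lemma j_indexP (R : realType) (eps delta : R) : 0 < eps -> 0 < delta ->
  exists j : nat, [/\ j_index eps delta = j%:R, (2 < j)%N &
    (1 + ln 3 `^ (-1 - eps)) / (eps * delta) <= ln (j%:R - 1) `^ eps].
Proof.
move=> e0 d0; rewrite /j_index; set C := (1 + _) / _.
have C0 : 0 < C by rewrite divr_gt0 ?mulr_gt0// ltr_wpDr ?powR_ge0.
set M := C `^ eps^-1; have M0 : 0 < M by rewrite powR_gt0.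
have eM : 1 < expR M by rewrite expR_gt1.
have c1 : (1 < Num.ceil (expR M))%R by rewrite ceil_gt_int.
case cE : (Num.ceil (expR M)) c1 => [c|//] c1.
exists c.+1; split; first by rewrite -natr1 addrC.
  by move: c1; lia.
have ec : expR M <= c%:R by rewrite -[c%:R]/(c%:~R) -cE ceil_ge.
rewrite -natr1 addrK.
have Ml : M <= ln c%:R.
  by rewrite -[leLHS]expRK ler_ln ?posrE ?expR_gt0// (lt_le_trans _ ec)// expR_gt0.
apply: (@le_trans _ _ (M `^ eps)).
  by rewrite -powRrM mulVf ?gt_eqF// powRr1// ltW.
apply: ge0_ler_powR; rewrite ?nnegrE ?(ltW M0) ?(ltW e0)//; lra.
Qed.

(* The first denominator in [K_const] is always [1]: since [b >= 2], the
   logarithm is at most [ln (5/2) < 1]. *)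
Lemma K_const_ge_N_index (R : realType) (b : nat) (eps delta : R) :
  (1 < b)%N -> 0 < eps -> (N_index b eps delta)%:R <= K_const b eps delta.
Proof.
move=> b1 e0; rewrite /K_const le_max; apply/orP; left.
rewrite (_ : Num.max _ 1 = 1) ?divr1//; apply: max_r.
have b2 : 2 <= b%:R :> R by rewrite ler_nat.
have bi0 : 0 < b%:R^-1 :> R by rewrite invr_gt0; lra.
have bi : b%:R^-1 <= 2^-1 :> R by rewrite lef_pV2 ?posrE//; lra.
have l1 : ln (b%:R^-1 + 2) <= 1 :> R.
  apply: le_trans (ln_5half_le1 R); rewrite ler_ln ?posrE//; lra.
have l0 : 0 <= ln (b%:R^-1 + 2) :> R by rewrite ln_ge0//; lra.
apply: mulr_ile1; rewrite ?powR_ge0//.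
  rewrite powRN invf_le1 ?powR_gt0//; last lra.
  rewrite -[leLHS](powRr0 b%:R) ler_powR//; lra.
apply: (@le_trans _ _ (1 `^ (1 / 3 + eps))); last by rewrite powR1.
apply: ge0_ler_powR; rewrite ?nnegrE//; lra.
Qed.

Lemma digit_count_large (R : realType) (b d j N : nat) (eps delta alpha : R) :
  (1 < b)%N -> 0 < eps -> (0 < j)%N -> cubic_log eps j%:R < N%:R / b%:R ->
  (forall k, (j <= k)%N -> (digit_count d b (block_end b eps k) alpha)%:R <=
    (block_end b eps k)%:R / b%:R + quad_log eps k%:R) ->
  (digit_count d b N alpha)%:R <= N%:R / b%:R +
    K_const b eps delta * N%:R `^ (2 / 3) * ln (N%:R + 2) `^ (1 / 3 + eps).
Proof.
move=> b1 e0 j0 jN hk; have b0 : (0 < b)%N := ltnW b1.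
have br0 : 0 < b%:R :> R by rewrite ltr0n.
(* The largest such k puts N/b between [cubic_log] at k and at k+1, whence N <= n_{k+1}. It exists
   because k <= [cubic_log] k < N/b <= N. *)
pose P k := (j <= k)%N && (cubic_log eps k%:R < N%:R / b%:R).
have exP : exists k, P k by exists j; rewrite /P leqnn.
have ubP k : P k -> (k <= N)%N.
  case/andP=> jk /ltW h; rewrite -(ler_nat R).
  have k1 : 1 <= k%:R :> R by rewrite ler1n (leq_trans j0).
  apply: le_trans (le_cubic_log e0 k1) _; apply: le_trans h _.
  by rewrite ler_pdivrMr// ler_peMr// ler1n.
have [k /andP[jk kN] kmax] := ex_maxnP exP ubP.
have k1 : 1 <= k%:R :> R by rewrite ler1n (leq_trans j0).
have N0 : (0 < N)%N.
  by case: N kN {jN P exP ubP kmax} => //; rewrite mul0r ltNge cubic_log_ge0.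
have Nk : N%:R / b%:R <= cubic_log eps k.+1%:R.
  rewrite leNgt; apply/negP => h; have := kmax k.+1.
  by rewrite /P h (leq_trans jk)// ltnn => /(_ isT).
have NM : (N <= block_end b eps k.+1)%N.
  rewrite -(ler_nat R) -(@ler_pM2r _ b%:R^-1) ?invr_gt0//.
  exact: le_trans Nk (ltW (block_end_gt _ _ b0)).
have h1 := leq_digit_count d b alpha NM; rewrite -(ler_nat R) in h1.
have h2 := hk k.+1 (leqW jk); have h3 := block_end_le eps k.+1 b0.
have h4 := block_gap_le e0 k1; rewrite natr1 in h4.
have h5 := quad_log_le b0 N0 e0 k1 (ltW kN).
set c2 := 4 * _ `^ _ * _ in h4.
set P2 := N%:R `^ (2 / 3) in h5 *; set P3 := ln _ `^ (1 / 3 + eps) in h5 *.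
set Q := ln _ `^ (2 * eps / 3) in h5.
have c20 : 0 <= c2.
  have l3 : 1 <= ln 3 :> R := ln3_ge1 R.
  rewrite !mulr_ge0 ?powR_ge0// !addr_ge0// divr_ge0 ?mulr_ge0 ?powR_ge0//; lra.
have hK : c2 / Q <= K_const b eps delta.
  rewrite /K_const le_max; apply/orP; right.
  by rewrite -/Q /c2 le_eqVlt; apply/orP; left; apply/eqP; ring.
have h6 : c2 * quad_log eps k%:R <= K_const b eps delta * P2 * P3.
  apply: le_trans (ler_wpM2l c20 h5) _.
  have -> : c2 * (P2 * P3 / Q) = c2 / Q * (P2 * P3) by ring.
  by rewrite -[leRHS]mulrA ler_wpM2r// mulr_ge0 ?powR_ge0.
lra.
Qed.

Theorem theorem8 (R : realType) (b : nat) (hb : (2 <= b)%N)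
    (d : nat) (hd : (d < b)%N) (eps delta : R)
    (heps : 0 < eps) (hdelta : 0 < delta) :
  exists E : set R,
    [/\ lebesgue_measurable E,
        E `<=` `[0, 1[,
        (completed_lebesgue_measure E <= delta%:E)%E &
        forall (alpha : R), (`[0, 1[ `\` E) alpha -> forall N : nat,
          (digit_count d b N alpha)%:R <=
            Num.min N%:R
              (N%:R / b%:R + K_const b eps delta * N%:R `^ (2 / 3) *
                 (ln (N%:R + 2)) `^ (1 / 3 + eps))].
Proof.
have b0 : (0 < b)%N := ltnW hb.
have [j [jE j2 hj]] := j_indexP heps hdelta.
set C := 1 + _ in hj; have C0 : 0 < C by rewrite ltr_wpDr ?powR_ge0.
pose F k : set R :=
  digit_excess_cover b d (block_end b eps k) (quad_log eps k%:R).
have mF k : measurable (F k) := measurable_digit_excess_cover _ _ _ _.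
(* The union runs over k >= j; the intersection is taken because closed prefix intervals can reach
   1. *)
pose E : set R := `[0, 1[ `&` \bigcup_(k in ~` `I_j) F k.
have mE : measurable E by apply: measurableI => //; exact: bigcup_measurable.
exists E; split.
- exact: sub_caratheodory.
- exact: subIsetl.
(* Both measures are given by the same outer measure, so the values agree by conversion. *)
- have -> : completed_lebesgue_measure E = lebesgue_measure E by [].
  have EF : E `<=` \bigcup_(k in ~` `I_j) F k := @subIsetr _ _ _.
  apply: le_trans (measure_sigma_subadditive_tail lebesgue_measure mF mE EF) _.
  apply: lime_le; first exact: is_cvg_nneseries.
  near=> n.
  have Fk k : (j <= k < n)%N -> (lebesgue_measure (F k) <=
      (C * (k%:R * ln k%:R `^ (1 + eps))^-1)%:E)%E.
    move=> /andP[jk _]; have k1 : 1 < k%:R :> R by rewrite ltr1n; lia.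
    apply: le_trans (digit_excess_cover_measure _ hd _) _.
      rewrite mulr_gt0 ?exprn_gt0 ?powR_gt0 ?ln_gt0//; lra.
    by rewrite lee_fin; apply: block_chebyshev_le => //; lia.
  rewrite big_nat_cond; apply: le_trans.
    by apply: lee_sum => k; rewrite andbT => /Fk; exact.
  rewrite -big_nat_cond sumEFin lee_fin -mulr_sumr.
  apply: le_trans (ler_wpM2l (ltW C0) (sum_inv_mul_ln_le n heps j2)) _.
  have l0 : 0 < ln (j%:R - 1) `^ eps.
    by apply: lt_le_trans hj; rewrite divr_gt0// mulr_gt0.
  rewrite ler_pdivrMr ?mulr_gt0// mulrA mulrC.
  by move: hj; rewrite ler_pdivrMr ?mulr_gt0// (mulrC delta).
- move=> alpha [/= a01 nE] N; rewrite le_min ler_nat digit_count_le/=.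
  rewrite in_itv/= in a01.
  (* At N = 0 both sides vanish, because 0 to the power 2/3 is 0. *)
  case: N => [|N].
    have -> : digit_count d b 0 alpha = 0%N.
      by apply/eqP; rewrite -leqn0 digit_count_le.
    by rewrite powR0 ?mul0r ?mulr0 ?mul0r ?addr0// gt_eqF//; lra.
  have hk k : (j <= k)%N -> (digit_count d b (block_end b eps k) alpha)%:R <=
      (block_end b eps k)%:R / b%:R + quad_log eps k%:R.
    move=> jk; apply: digit_excess_coverP => // Fa; apply: nE; split.
      by rewrite /= in_itv.
    by exists k => //=; apply/negP; rewrite -leqNgt.
  have [+ Nmin] := N_index_exists b0 eps delta.
  rewrite jE => Nj.
  (* From [N_index] on, N/b exceeds [cubic_log] j and the block argument applies. Below it, the
     count is at most [N_index] <= [K_const], and the factors N^(2/3) and ln^(1/3+eps) (N+2) are at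
     least 1. *)
  have [NI|IN] := ltnP N.+1 (N_index b eps delta); last first.
    apply: (@digit_count_large _ _ _ j) => //; first by lia.
    by apply: lt_le_trans Nj _; rewrite ler_wpM2r ?invr_ge0// ler_nat.
  have N1 : 1 <= N.+1%:R :> R by rewrite ler1n.
  have p1 : 1 <= N.+1%:R `^ (2 / 3) :> R.
    by rewrite -[leLHS](powRr0 N.+1%:R) ler_powR//; lra.
  have l1 : 1 <= ln (N.+1%:R + 2) :> R.
    by apply: le_trans (ln3_ge1 R) _; rewrite ler_ln ?posrE//; lra.
  have p2 : 1 <= ln (N.+1%:R + 2) `^ (1 / 3 + eps) :> R.
    by rewrite -[leLHS](powRr0 (ln (N.+1%:R + 2))) ler_powR//; lra.
  have hK := K_const_ge_N_index delta hb heps.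
  have K0 : 0 <= K_const b eps delta by apply: le_trans hK.
  apply: (@le_trans _ _ (K_const b eps delta)).
    apply: le_trans hK; rewrite ler_nat.
    exact: leq_trans (digit_count_le _ _ _ _) (ltnW NI).
  rewrite ler_wpDl ?divr_ge0// -mulrA ler_peMr//.
  by rewrite -[leLHS]mulr1 ler_pM.
Unshelve. all: by end_near. Qed.
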